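(* Let $f:\operatorname{dom} f\subseteq\mathbb{R}^n\to\mathbb{R}$ be $\mathcal{C}^3$ on $B(x^0,\overline{\Delta})$, where $x^0\in\operatorname{dom} f$ and $\overline{\Delta}>0$, and suppose $\nabla^2 f$ is Lipschitz continuous on $\overline{B}(x^0,\overline{\Delta})$ with Lipschitz constant $L_{\nabla^2 f}\ge 0$. Let $S=[s^1\ s^2\ \cdots\ s^m]\in\mathbb{R}^{n\times m}$ and $T_i=[t_i^1\ t_i^2\ \cdots\ t_i^{k_i}]\in\mathbb{R}^{n\times k_i}$ for $i\in\{1,\dots,m\}$ be nonzero matrices. Assume that $B(x^0,\Delta_{T_i})\subset B(x^0,\overline{\Delta})$ and $B(x^0+s^i,\Delta_{T_i})\subset B(x^0,\overline{\Delta})$ for all $i\in\{1,\dots,m\}$. Then the following hold. (i) If $S$ has full column rank, or if $T_i$ has full row rank for all $i\in\{1,\dots,m\}$, then $$\|\operatorname{Proj}_{S,T_{1:m}}\nabla_s^2 f(x^0;S,T_{1:m})-\operatorname{Proj}_{S,T_{1:m}}\nabla^2 f(x^0)\|=\|\nabla_s^2 f(x^0;S,T_{1:m})-\operatorname{Proj}_{S,T_{1:m}}\nabla^2 f(x^0)\|$$ $$\le 4m\sqrt{k}\,L_{\nabla^2 f}\,\|(\widehat{S}^\top)^\dagger\|\,\|\widehat{T}^\dagger\|\left(\frac{\Delta_u}{\Delta_l}\right)^2\Delta_u .$$ (ii) If $T_1=T_2=\cdots=T_m=:\overline{T}$, then $$\|\operatorname{Proj}_{S,\overline{T}}\nabla_s^2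 f(x^0;S,\overline{T})-\operatorname{Proj}_{S,\overline{T}}\nabla^2 f(x^0)\|=\|\nabla_s^2 f(x^0;S,\overline{T})-\operatorname{Proj}_{S,\overline{T}}\nabla^2 f(x^0)\|$$ $$\le 4\sqrt{mk}\,L_{\nabla^2 f}\,\frac{\Delta_u}{\Delta_l}\,\|(\widehat{S}^\top)^\dagger\|\,\|\widehat{T}^\dagger\|\,\Delta_u .$$
   Context: $B(x,\Delta)$ and $\overline{B}(x,\Delta)$ are the open and closed Euclidean balls. $\|\cdot\|$ is the Euclidean norm for vectors and the induced (spectral) norm for matrices. $A^\dagger$ is the Moore–Penrose pseudoinverse of $A$. $e_m^i$ is the $i$-th standard basis vector of $\mathbb{R}^m$. For $x\in\operatorname{dom} f$ and $T=[t^1\cdots t^k]\in\mathbb{R}^{n\times k}$ with all $x+t^j\in\operatorname{dom} f$, let $\delta_s(x;T)\in\mathbb{R}^k$ be the vector with entries $f(x+t^j)-f(x)$. The generalized simplex gradient is $\nabla_s f(x;T)=(T^\top)^\dagger\delta_s(x;T)\in\mathbb{R}^n$. For $S=[s^1\cdots s^m]\in\mathbb{R}^{n\times m}$ and $T_{1:m}=\{T_1,\dots,T_m\}$ with $T_i\in\mathbb{R}^{n\times k_i}$, the generalized simplex Hessian (GSH) is $$\nabla_s^2 f(x^0;S,T_{1:m})=(S^\top)^\dagger\,\delta_s^2(x^0;S,T_{1:m})\in\mathbb{R}^{n\times n},$$ where $\delta_s^2(x^0;S,T_{1:m})\in\mathbb{R}^{m\times n}$ has $i$-th row $(\nabla_s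 f(x^0+s^i;T_i)-\nabla_s f(x^0;T_i))^\top$. If all $T_i$ equal $\overline{T}$ one writes $\nabla_s^2 f(x^0;S,\overline{T})$. For $H\in\mathbb{R}^{n\times n}$, $\operatorname{Proj}_{S,T_{1:m}}H=\sum_{i=1}^m (S^\top)^\dagger e_m^i(e_m^i)^\top S^\top H\,T_iT_i^\dagger$; if all $T_i$ equal $\overline{T}$ this is $\operatorname{Proj}_{S,\overline{T}}H=(S^\top)^\dagger S^\top H\,\overline{T}\,\overline{T}^\dagger$. $\Delta_S=\max_i\|s^i\|$, $\Delta_{T_i}=\max_j\|t_i^j\|$, $\widehat{S}=S/\Delta_S$, $\widehat{T}_i=T_i/\Delta_{T_i}$, $\Delta_u=\max\{\Delta_S,\Delta_{T_1},\dots,\Delta_{T_m}\}$, $\Delta_l=\min\{\Delta_S,\Delta_{T_1},\dots,\Delta_{T_m}\}$, $k=\max\{k_1,\dots,k_m\}$, and $\widehat{T}$ is a $\widehat{T}_i$ for which $\|\widehat{T}_i^\dagger\|$ is maximal over $i\in\{1,\dots,m\}$. *)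

(* Defs.v *)
From mathcomp Require Import all_boot all_order all_algebra.
From mathcomp Require Import all_classical all_reals all_analysis.

Set Implicit Arguments.
Unset Strict Implicit.
Unset Printing Implicit Defensive.

Import Order.TTheory GRing.Theory Num.Theory.
Import numFieldNormedType.Exports.
Local Open Scope classical_set_scope.
Local Open Scope ring_scope.

(* MathComp-Analysis norms matrices by the maximum of the absolute values of
   the entries, so the Euclidean norm, its balls and the spectral norm are
   defined here.  Differentiability does not depend on this choice. *)
Section Norms.
Variable R : realType.

Definition enorm n (v : 'cV[R]_n) : R := Num.sqrt (\sum_i v i 0 ^+ 2).

Definition eball n (x : 'cV[R]_n) (r : R) : set 'cV[R]_n :=
  [set y | enorm (y - x) < r].

Definition ecball n (x : 'cV[R]_n) (r : R) : set 'cV[R]_n :=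
  [set y | enorm (y - x) <= r].

Definition opnorm m n (A : 'M[R]_(m, n)) : R :=
  sup [set enorm (A *m v) | v in [set v : 'cV[R]_n | enorm v <= 1]].

End Norms.

Section MoorePenrose.
Variable R : realType.

Definition is_mpinv m n (A : 'M[R]_(m, n)) (X : 'M[R]_(n, m)) : Prop :=
  [/\ A *m X *m A = A, X *m A *m X = X,
      (A *m X)^T = A *m X & (X *m A)^T = X *m A].

Definition mpinv m n (A : 'M[R]_(m, n)) : 'M[R]_(n, m) :=
  xget 0 [set X | is_mpinv A X].

Lemma is_mpinv_unique m n (A : 'M[R]_(m, n)) X Y :
  is_mpinv A X -> is_mpinv A Y -> X = Y.
Proof.
move=> [x1 x2 x3 x4] [y1 y2 y3 y4].
have eqA : A *m X = A *m Y.
  rewrite -x3 -{1}y1 -mulmxA trmx_mul x3 y3 mulmxA.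
  by rewrite x1.
have eqB : X *m A = Y *m A.
  rewrite -x4 -{1}y1 -(mulmxA A) mulmxA trmx_mul y4 x4.
  by rewrite -!mulmxA (mulmxA A X A) x1.
by rewrite -x2 eqB -mulmxA eqA mulmxA y2.
Qed.

Lemma row_free_gram m n (F : 'M[R]_(m, n)) :
  row_free F -> F *m F^T \in unitmx.
Proof.
move=> Ffree; rewrite -row_free_unit -kermx_eq0; apply/eqP/row_matrixP => i.
rewrite row0; set u := row i _.
have uG : u *m (F *m F^T) = 0.
  by apply/sub_kermxP; exact: row_sub.
have uF : u *m F = 0.
  apply/rowP => j; rewrite [RHS]mxE.
  have : \sum_j (u *m F) 0 j ^+ 2 = 0.
    transitivity ((u *m F *m (u *m F)^T) 0 0).
      by rewrite [RHS]mxE; apply: eq_bigr => l _; rewrite [_^T _ _]mxE expr2.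
    by rewrite trmx_mul mulmxA -(mulmxA u) uG mul0mx mxE.
  move=> /psumr_eq0P-/(_ (fun l _ => sqr_ge0 _))/(_ j isT)/eqP.
  by rewrite sqrf_eq0 => /eqP.
by apply: (row_free_inj Ffree); rewrite uF mul0mx.
Qed.

Lemma is_mpinv_exists m n (A : 'M[R]_(m, n)) : exists X, is_mpinv A X.
Proof.
have [r [C [F [defA Cfull Ffree]]]] :
    exists (r : nat) (C : 'M[R]_(m, r)) (F : 'M[R]_(r, n)),
    [/\ A = C *m F, row_full C & row_free F].
  exists (\rank A), (col_base A), (row_base A).
  by rewrite mulmx_base col_base_full row_base_free.
have uF : F *m F^T \in unitmx by exact: row_free_gram.
have uC : C^T *m C \in unitmx.
  by rewrite -[X in _ *m X]trmxK row_free_gram // /row_free mxrank_tr.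
have sF : (invmx (F *m F^T))^T = invmx (F *m F^T).
  by rewrite trmx_inv trmx_mul trmxK.
have sC : (invmx (C^T *m C))^T = invmx (C^T *m C).
  by rewrite trmx_inv trmx_mul trmxK.
pose X := F^T *m invmx (F *m F^T) *m (invmx (C^T *m C) *m C^T).
have AX : A *m X = C *m invmx (C^T *m C) *m C^T.
  by rewrite defA /X !mulmxA -(mulmxA C F) mulmxK.
have XA : X *m A = F^T *m invmx (F *m F^T) *m F.
  rewrite defA /X -!mulmxA (mulmxA C^T) (mulmxA (invmx (C^T *m C))).
  by rewrite mulVmx // mul1mx.
exists X; split.
- by rewrite AX defA -!mulmxA (mulmxA C^T) (mulmxA (invmx (C^T *m C)))
    mulVmx // mul1mx.
- by rewrite XA /X -!mulmxA (mulmxA F) (mulmxA (F *m F^T)) mulmxV // mul1mx.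
- by rewrite AX !trmx_mul trmxK sC mulmxA.
- by rewrite XA !trmx_mul trmxK sF mulmxA.
Qed.

Lemma mpinvP m n (A : 'M[R]_(m, n)) : is_mpinv A (mpinv A).
Proof.
have [X AX] := is_mpinv_exists A.
exact: (@xgetPex _ 0 [set X | is_mpinv A X] (ex_intro _ X AX)).
Qed.

End MoorePenrose.

(* A function f : dom f -> R is given by its domain D and a total function
   whose values outside D are irrelevant. *)
Section Derivatives.
Variables (R : realType) (n : nat).
Implicit Types (D U : set 'cV[R]_n) (f : 'cV[R]_n -> R) (x : 'cV[R]_n).

Definition grad f x : 'cV[R]_n := \col_i 'D_(delta_mx i 0) f x.

Definition hess f x : 'M[R]_n :=
  \matrix_(i, j) 'D_(delta_mx j 0) (fun y => grad f y i 0) x.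

Fixpoint C_on (p : nat) U f : Prop :=
  match p with
  | 0 => forall x, U x -> {for x, continuous f}
  | q.+1 => (forall x, U x -> differentiable f x) /\
            (forall i : 'I_n, C_on q U (fun y => 'D_(delta_mx i 0) f y))
  end.

Definition twice_differentiable_at D f x : Prop :=
  [/\ D^° x, \forall y \near x, differentiable f y
    & differentiable (grad f) x].

(* Lipschitz continuity on U includes the existence of the Hessian at every
   point of U: the closed ball is not covered by a C^3 hypothesis on the open
   ball. *)
Definition hess_lipschitz_on D U f (L : R) : Prop :=
  (forall x, U x -> twice_differentiable_at D f x) /\
  (forall x y, U x -> U y ->
     opnorm (hess f x - hess f y) <= L * enorm (x - y)).

End Derivatives.

Section Simplex.
Variables (R : realType) (n : nat).
Implicit Types (f : 'cV[R]_n -> R) (x : 'cV[R]_n).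

Definition simplex_delta k f x (T : 'M[R]_(n, k)) : 'cV[R]_k :=
  \col_j (f (x + col j T) - f x).

Definition simplex_grad k f x (T : 'M[R]_(n, k)) : 'cV[R]_n :=
  mpinv T^T *m simplex_delta f x T.

Section Hessian.
Variables (m : nat) (k : 'I_m -> nat).
Implicit Types (S : 'M[R]_(n, m)) (T : forall i : 'I_m, 'M[R]_(n, k i)).

Definition simplex_delta2 f x S T : 'M[R]_(m, n) :=
  \matrix_(i < m)
    (simplex_grad f (x + col i S) (T i) - simplex_grad f x (T i))^T.

Definition gsh f x S T : 'M[R]_n := mpinv S^T *m simplex_delta2 f x S T.

Definition gshProj S T (H : 'M[R]_n) : 'M[R]_n :=
  \sum_(i < m) mpinv S^T *m delta_mx i (0 : 'I_1) *m (delta_mx i (0 : 'I_1))^T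
               *m S^T *m H *m T i *m mpinv (T i).

End Hessian.

Lemma gshProj_const m k (S : 'M[R]_(n, m)) (T : 'M[R]_(n, k)) (H : 'M[R]_n) :
  gshProj S (fun=> T) H = mpinv S^T *m S^T *m H *m T *m mpinv T.
Proof.
rewrite /gshProj -!mulmx_suml; do 4 congr (_ *m _).
under eq_bigr do rewrite -mulmxA.
rewrite -mulmx_sumr -[RHS]mulmx1; congr (_ *m _).
rewrite [RHS]mx1_sum_delta; apply: eq_bigr => i _.
by rewrite trmx_delta mul_delta_mx.
Qed.

(* Delta_A for a matrix A of directions; colnormalize A is A-hat. *)
Definition maxcolnorm k (A : 'M[R]_(n, k)) : R :=
  \big[Num.max/0]_(j < k) enorm (col j A).

Definition colnormalize k (A : 'M[R]_(n, k)) : 'M[R]_(n, k) :=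
  (maxcolnorm A)^-1 *: A.

Definition delta_u m (k : 'I_m -> nat) (S : 'M[R]_(n, m))
    (T : forall i : 'I_m, 'M[R]_(n, k i)) : R :=
  \big[Num.max/maxcolnorm S]_(i < m) maxcolnorm (T i).

Definition delta_l m (k : 'I_m -> nat) (S : 'M[R]_(n, m))
    (T : forall i : 'I_m, 'M[R]_(n, k i)) : R :=
  \big[Num.min/maxcolnorm S]_(i < m) maxcolnorm (T i).

End Simplex.

(* Main.v *)
(* Two applications of the mean value theorem write a second difference
   f(x+s+t) - f(x+s) - f(x+t) + f(x) as s^T (hess f y) t, with y in the
   parallelogram spanned at x by s and t, hence in the closed ball; by the
   Lipschitz bound it differs from s^T (hess f x) t by at most
   L (|s| + |t|) |s| |t|.  The pseudoinverse identities give
   gsh - Proj(hess) = (S^T)^dagger E, where row i of E is the image under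
   (T_i^T)^dagger of the vector of these errors.  Bounding the spectral norm
   of E by its Frobenius norm yields
   2 sqrt(mk) L |(S-hat^T)^dagger| |T-hat^dagger| Delta_u, and this is below
   both claimed bounds because Delta_u / Delta_l >= 1. *)
Require Import Defs.
From mathcomp Require Import all_boot all_order all_algebra.
From mathcomp Require Import all_classical all_reals all_analysis.
From mathcomp Require Import ring lra.

Set Implicit Arguments.
Unset Strict Implicit.
Unset Printing Implicit Defensive.

Import Order.TTheory GRing.Theory Num.Theory.
Import numFieldNormedType.Exports.
Local Open Scope classical_set_scope.
Local Open Scope ring_scope.

(** * Euclidean, Frobenius and spectral norms *)

Section EuclideanNorm.
Variable R : realType.
Implicit Types m n p : nat.

Lemma enorm_ge0 n (v : 'cV[R]_n) : 0 <= enorm v.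
Proof. exact: sqrtr_ge0. Qed.

Lemma sqr_enorm n (v : 'cV[R]_n) : enorm v ^+ 2 = \sum_i v i 0 ^+ 2.
Proof. by rewrite sqr_sqrtr // sumr_ge0 // => i _; exact: sqr_ge0. Qed.

Lemma dot_enorm n (v : 'cV[R]_n) : (v^T *m v) 0 0 = enorm v ^+ 2.
Proof. by rewrite sqr_enorm mxE; apply: eq_bigr => i _; rewrite mxE expr2. Qed.

Lemma enorm_sqr_comb n (a b : R) (u v : 'cV[R]_n) :
  enorm (a *: u + b *: v) ^+ 2 =
    a ^+ 2 * enorm u ^+ 2 + 2 * a * b * (u^T *m v) 0 0
    + b ^+ 2 * enorm v ^+ 2.
Proof.
rewrite !sqr_enorm [(u^T *m v) 0 0]mxE !mulr_sumr -!big_split /=.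
by apply: eq_bigr => i _; rewrite !mxE; ring.
Qed.

Lemma enorm0 n : enorm (0 : 'cV[R]_n) = 0.
Proof.
by rewrite /enorm big1 ?sqrtr0 // => i _; rewrite mxE expr0n.
Qed.

Lemma enormZ n (a : R) (v : 'cV[R]_n) : enorm (a *: v) = `|a| * enorm v.
Proof.
rewrite /enorm -sqrtr_sqr -sqrtrM ?sqr_ge0 // mulr_sumr; congr Num.sqrt.
by apply: eq_bigr => i _; rewrite mxE exprMn.
Qed.

Lemma enorm_gt0 n (v : 'cV[R]_n) : v != 0 -> 0 < enorm v.
Proof.
move=> v0; rewrite lt_neqAle enorm_ge0 andbT eq_sym.
apply: contra_neq v0 => v0; apply/colP => i; rewrite mxE.
have : \sum_i v i 0 ^+ 2 = 0 by rewrite -sqr_enorm v0 expr0n.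
move=> /psumr_eq0P-/(_ (fun l _ => sqr_ge0 _))/(_ i isT)/eqP.
by rewrite sqrf_eq0 => /eqP.
Qed.

(** For nonzero [v], the squared norm of [enorm v ^+ 2 *: u + (- C) *: v] expands to [enorm v ^+ 2]
    times the defect of the squared inequality, which is therefore nonnegative. *)
Lemma cauchy_schwarz n (u v : 'cV[R]_n) :
  `|(u^T *m v) 0 0| <= enorm u * enorm v.
Proof.
have [-> |v0] := eqVneq v 0; first by rewrite mulmx0 mxE normr0 enorm0 mulr0.
have v2 : 0 < enorm v ^+ 2 by rewrite exprn_gt0 ?enorm_gt0.
set C := (u^T *m v) 0 0.
rewrite -(@ler_pXn2r _ 2) ?nnegrE ?mulr_ge0 ?enorm_ge0 //.
rewrite real_normK ?num_real // exprMn -subr_ge0 -(pmulr_rge0 _ v2).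
suff -> : enorm v ^+ 2 * (enorm u ^+ 2 * enorm v ^+ 2 - C ^+ 2) =
    enorm (enorm v ^+ 2 *: u + (- C) *: v) ^+ 2 by exact: sqr_ge0.
by rewrite enorm_sqr_comb -/C; ring.
Qed.

Lemma enormD n (u v : 'cV[R]_n) : enorm (u + v) <= enorm u + enorm v.
Proof.
rewrite -(@ler_pXn2r _ 2) ?nnegrE ?addr_ge0 ?enorm_ge0 //.
rewrite -[X in enorm (X + _)]scale1r -[X in enorm (_ + X)]scale1r.
rewrite enorm_sqr_comb.
rewrite !expr1n !mul1r !mulr1 sqrrD lerD2r lerD2l.
rewrite -[X in _ <= X]mulr_natl ler_pM2l ?ltr0n //.
exact: le_trans (ler_norm _) (cauchy_schwarz _ _).
Qed.

Definition frob m n (A : 'M[R]_(m, n)) : R :=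
  Num.sqrt (\sum_i enorm (row i A)^T ^+ 2).

Lemma sqr_frob m n (A : 'M[R]_(m, n)) :
  frob A ^+ 2 = \sum_i enorm (row i A)^T ^+ 2.
Proof. by rewrite sqr_sqrtr // sumr_ge0 // => i _; exact: sqr_ge0. Qed.

Lemma enorm_mul_frob m n (A : 'M[R]_(m, n)) (v : 'cV[R]_n) :
  enorm (A *m v) <= frob A * enorm v.
Proof.
rewrite -(@ler_pXn2r _ 2) ?nnegrE ?mulr_ge0 ?enorm_ge0 ?sqrtr_ge0 //.
rewrite exprMn sqr_frob sqr_enorm mulr_suml; apply: ler_sum => i _.
have -> : (A *m v) i 0 = ((row i A)^T^T *m v) 0 0.
  by rewrite trmxK -row_mul [RHS]mxE.
rewrite -exprMn -real_normK ?num_real //.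
by rewrite ler_pXn2r ?nnegrE ?mulr_ge0 ?enorm_ge0 //; exact: cauchy_schwarz.
Qed.

(** The [sup] defining [opnorm] is meaningful only on a nonempty bounded set; the Frobenius norm
    supplies the bound. *)
Lemma opnorm_has_sup m n (A : 'M[R]_(m, n)) :
  has_sup [set enorm (A *m v) | v in [set v : 'cV[R]_n | enorm v <= 1]].
Proof.
split; first by exists (enorm (A *m 0)), 0 => //=; rewrite enorm0.
exists (frob A) => _ [v /= v1 <-].
apply: le_trans (enorm_mul_frob _ _) _.
by rewrite ler_piMr // sqrtr_ge0.
Qed.

Lemma opnorm_le m n (A : 'M[R]_(m, n)) c : 0 <= c ->
  (forall v, enorm (A *m v) <= c * enorm v) -> opnorm A <= c.
Proof.
move=> c0 Ac; apply: ge_sup; first by case: (opnorm_has_sup A).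
move=> _ [v /= v1 <-]; apply: le_trans (Ac v) _.
by rewrite ler_piMr.
Qed.

Lemma opnorm_ge0 m n (A : 'M[R]_(m, n)) : 0 <= opnorm A.
Proof.
have -> : 0 = enorm (A *m 0) by rewrite mulmx0 enorm0.
apply: ub_le_sup; first by case: (opnorm_has_sup A).
by exists 0 => //=; rewrite enorm0.
Qed.

Lemma enorm_mul m n (A : 'M[R]_(m, n)) v :
  enorm (A *m v) <= opnorm A * enorm v.
Proof.
have [->|v0] := eqVneq v 0; first by rewrite mulmx0 !enorm0 mulr0.
have nv := enorm_gt0 v0.
rewrite -ler_pdivrMr //.
have -> : enorm (A *m v) / enorm v = enorm (A *m ((enorm v)^-1 *: v)).
  by rewrite -scalemxAr enormZ ger0_norm ?invr_ge0 ?ltW // mulrC.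
apply: ub_le_sup; first by case: (opnorm_has_sup A).
exists ((enorm v)^-1 *: v) => //=.
by rewrite enormZ ger0_norm ?invr_ge0 ?enorm_ge0 // mulVf // lt0r_neq0.
Qed.

Lemma opnorm_frob m n (A : 'M[R]_(m, n)) : opnorm A <= frob A.
Proof. by apply: opnorm_le; [exact: sqrtr_ge0 | exact: enorm_mul_frob]. Qed.

Lemma opnormM m n p (A : 'M[R]_(m, n)) (B : 'M[R]_(n, p)) :
  opnorm (A *m B) <= opnorm A * opnorm B.
Proof.
apply: opnorm_le => [|v]; first by rewrite mulr_ge0 ?opnorm_ge0.
rewrite -mulmxA -mulrA; apply: le_trans (enorm_mul _ _) _.
by rewrite ler_wpM2l ?opnorm_ge0 ?enorm_mul.
Qed.

Lemma opnormZ m n (a : R) (A : 'M[R]_(m, n)) :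
  opnorm (a *: A) <= `|a| * opnorm A.
Proof.
apply: opnorm_le => [|v]; first by rewrite mulr_ge0 ?opnorm_ge0.
by rewrite -scalemxAl enormZ -mulrA ler_wpM2l ?enorm_mul.
Qed.

(** The square of [enorm (A^T *m v)] is the inner product of [v] with [A *m (A^T *m v)];
    Cauchy-Schwarz and division by [enorm (A^T *m v)] conclude. *)
Lemma opnorm_tr m n (A : 'M[R]_(m, n)) : opnorm A^T <= opnorm A.
Proof.
apply: opnorm_le => [|v]; first exact: opnorm_ge0.
have [->|Av] := eqVneq (A^T *m v) 0.
  by rewrite enorm0 mulr_ge0 ?opnorm_ge0 ?enorm_ge0.
rewrite -(ler_pM2r (enorm_gt0 Av)) -expr2 -dot_enorm trmx_mul trmxK -mulmxA.
apply: le_trans (ler_norm _) _; apply: le_trans (cauchy_schwarz _ _) _.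
by rewrite mulrC mulrAC ler_wpM2r ?enorm_ge0 ?enorm_mul.
Qed.

Lemma enorm_le_const n (v : 'cV[R]_n) c : 0 <= c ->
  (forall i, `|v i 0| <= c) -> enorm v <= Num.sqrt n%:R * c.
Proof.
move=> c0 vc; rewrite -[c]ger0_norm // -sqrtr_sqr -sqrtrM ?ler0n //.
rewrite ler_sqrt ?mulr_ge0 ?sqr_ge0 ?ler0n //.
apply: (@le_trans _ _ (\sum_(i < n) c ^+ 2)).
  by apply: ler_sum => i _; rewrite -real_normK ?num_real // lerXn2r ?nnegrE.
by rewrite sumr_const card_ord mulr_natl.
Qed.

(** The squared Frobenius norm adds up [m] squared row norms, hence the factor [Num.sqrt m%:R]
    rather than [m%:R]. *)
Lemma opnorm_le_rows m n (A : 'M[R]_(m, n)) c : 0 <= c ->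
  (forall i, enorm (row i A)^T <= c) -> opnorm A <= Num.sqrt m%:R * c.
Proof.
move=> c0 Ac; apply: le_trans (opnorm_frob A) _.
rewrite -[c]ger0_norm // -sqrtr_sqr -sqrtrM ?ler0n //.
rewrite ler_sqrt ?mulr_ge0 ?sqr_ge0 ?ler0n //.
apply: (@le_trans _ _ (\sum_(i < m) c ^+ 2)).
  by apply: ler_sum => i _; rewrite lerXn2r ?nnegrE ?enorm_ge0.
by rewrite sumr_const card_ord mulr_natl.
Qed.

End EuclideanNorm.

(** * Algebra of the Moore-Penrose pseudoinverse *)

Section MoorePenroseFacts.
Variable R : realType.

Lemma mpinv_eq m n (A : 'M[R]_(m, n)) X : is_mpinv A X -> mpinv A = X.
Proof. exact: is_mpinv_unique (mpinvP A). Qed.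

(** The Penrose equations are stable under transposition, which exchanges the two symmetry
    conditions. *)
Lemma mpinv_tr m n (A : 'M[R]_(m, n)) : mpinv A^T = (mpinv A)^T.
Proof.
have [h1 h2 h3 h4] := mpinvP A.
apply: mpinv_eq; split.
- by rewrite -!trmx_mul mulmxA h1.
- by rewrite -!trmx_mul mulmxA h2.
- by rewrite -trmx_mul h4.
- by rewrite -trmx_mul h3.
Qed.

Lemma mpinvZ m n (a : R) (A : 'M[R]_(m, n)) :
  a != 0 -> mpinv (a *: A) = a^-1 *: mpinv A.
Proof.
move=> a0; have [h1 h2 h3 h4] := mpinvP A.
have aV : a^-1 * a = 1 by rewrite mulVf.
have Va : a * a^-1 = 1 by rewrite mulfV.
apply: mpinv_eq; split; rewrite -!(scalemxAl, scalemxAr) !scalerA.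
- by rewrite Va mulr1 h1.
- by rewrite -mulrA aV mulr1 h2.
- by rewrite Va !scale1r h3.
- by rewrite aV !scale1r h4.
Qed.

Lemma mulmx_mpinv m n (A : 'M[R]_(m, n)) : row_free A -> A *m mpinv A = 1%:M.
Proof.
move=> Af; have [h1 _ _ _] := mpinvP A.
by apply: (row_free_inj Af); rewrite h1 mul1mx.
Qed.

End MoorePenroseFacts.

(** * Mean value theorem and second differences *)

Section MeanValue.
Variables (R : realType) (n : nat).
Implicit Types (f : 'cV[R]_n -> R) (x s t v : 'cV[R]_n).

(** Both derivatives are limits of the same difference quotient in [h]. *)
Lemma is_derive_line f x v (a : R) : differentiable f (x + a *: v) ->
  is_derive a 1 (fun b : R => f (x + b *: v)) ('D_v f (x + a *: v)).
Proof.
move=> df.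
have E : (fun h : R => h^-1 *: (((fun b : R => f (x + b *: v)) \o shift a)
             (h *: 1) - f (x + a *: v))) =
         (fun h : R => h^-1 *: ((f \o shift (x + a *: v)) (h *: v)
             - f (x + a *: v))).
  apply/funext => h /=; congr (_ *: (f _ - _)).
  by rewrite scalerDl [h *: 1]mulr1 addrCA.
have dv := @diff_derivable _ _ _ f _ v df.
by split; rewrite /derivable /derive E.
Qed.

Lemma mean_value_segment f x v :
  (forall a : R, 0 <= a <= 1 -> differentiable f (x + a *: v)) ->
  exists2 c : R, 0 <= c <= 1 & f (x + v) - f x = 'D_v f (x + c *: v).
Proof.
move=> df; pose g (b : R) := f (x + b *: v).
have dg (b : R) : 0 <= b <= 1 -> is_derive b 1 g ('D_v f (x + b *: v)).
  by move=> /df; exact: is_derive_line.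
have [|||c c01] := @MVT_segment R g (fun b : R => 'D_v f (x + b *: v)) 0 1.
- exact: ler01.
- by move=> b; rewrite in_itv /= => /andP[b0 b1]; apply: dg; rewrite !ltW.
- apply: derivable_within_continuous => b; rewrite in_itv /= => b01.
  by have [] := dg b b01.
rewrite /g scale1r scale0r addr0 subr0 mulr1 => fE.
by exists c => //; rewrite in_itv /= in c01.
Qed.

Lemma derive_sum_partial f x v : differentiable f x ->
  'D_v f x = \sum_i v i 0 * 'D_(delta_mx i 0) f x.
Proof.
move=> df.
have vE : v = \sum_i v i 0 *: delta_mx i 0.
  by rewrite {1}[v]matrix_sum_delta; apply: eq_bigr => i _; rewrite big_ord1.
rewrite deriveE // {1}vE linear_sum /=; apply: eq_bigr => i _.
by rewrite linearZ /= deriveE.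
Qed.

(** The mean value theorem is applied along [s] to the first difference [F] in direction [t], then
    along [t] to the derivative of [f] in direction [s]. *)
Lemma second_difference f x s t :
  (forall a b : R, 0 <= a <= 1 -> 0 <= b <= 1 ->
     differentiable f (x + a *: s + b *: t) /\
     differentiable (grad f) (x + a *: s + b *: t)) ->
  exists a b : R, [/\ 0 <= a <= 1, 0 <= b <= 1 &
    f (x + s + t) - f (x + s) - (f (x + t) - f x) =
    (s^T *m hess f (x + a *: s + b *: t) *m t) 0 0].
Proof.
move=> df.
pose F y := f (y + t) - f y.
(* The sides [b = 1] and [b = 0] of the parallelogram carry the two terms of [F]. *)
have dft (a : R) : 0 <= a <= 1 ->
    differentiable (fun y => f (y + t)) (x + a *: s).
  move=> a01; apply: (@differentiable_comp _ _ _ _ (fun y => y + t) f).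
    by [].
  by have [] := df a 1 a01; rewrite ?ler01 ?lexx // scale1r.
have df0 (a : R) : 0 <= a <= 1 -> differentiable f (x + a *: s).
  by move=> a01; have [] := df a 0 a01; rewrite ?ler01 ?lexx // scale0r addr0.
have [|a a01 FE] := @mean_value_segment F x s.
  by move=> a a01; apply: differentiableB; [exact: dft | exact: df0].
(* [G] is the derivative of [f] in direction [s], so the derivative of [F] along [s] is again a
   first difference, now of [G]. *)
pose G y := \sum_i s i 0 * grad f y i 0.
have DF : 'D_s F (x + a *: s) = G (x + a *: s + t) - G (x + a *: s).
  rewrite (deriveB (diff_derivable (dft a a01)) (diff_derivable (df0 a a01))).
  rewrite (derive_sum_partial s (dft a a01)) (derive_sum_partial s (df0 a a01)).
  have shD (v : 'cV[R]_n) :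
      'D_v (fun y => f (y + t)) (x + a *: s) = 'D_v f (x + a *: s + t).
    have E : (fun h : R => h^-1 *: (((fun y => f (y + t)) \o shift (x + a *: s))
                 (h *: v) - f (x + a *: s + t))) =
             (fun h : R => h^-1 *: ((f \o shift (x + a *: s + t)) (h *: v)
                 - f (x + a *: s + t))).
      by apply/funext => h /=; rewrite -addrA.
    by rewrite /derive E.
  congr (_ - _).
    by apply: eq_bigr => i _; rewrite shD mxE.
  by apply: eq_bigr => i _; rewrite mxE.
have dgi (i : 'I_n) y : differentiable (grad f) y ->
    differentiable (fun y => grad f y i 0) y.
  move=> dg.
  exact: (@differentiable_comp R _ _ _ (grad f) (fun N : 'cV[R]_n => N i 0) y dg
            (differentiable_coord _ _ _)).
(* Recast as a linear combination of functions, [G] matches the sum and scaling rules for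
   derivatives. *)
have GE : G = \sum_i (s i 0 *: (fun y => grad f y i 0)).
  by apply/funext => y; rewrite fct_sumE.
have dG y : differentiable (grad f) y -> differentiable G y.
  move=> dg; rewrite GE; apply: differentiable_sum => i.
  by apply: differentiableZ; exact: dgi.
have [|b b01 DGE] := @mean_value_segment G (x + a *: s) t.
  by move=> b b01; apply: dG; have [] := df a b a01 b01.
exists a, b; split => //.
have [_ dg] := df a b a01 b01.
rewrite -/(F (x + s)) -/(F x) FE DF DGE GE derive_sum; last first.
  by move=> i; apply: derivableZ; apply: diff_derivable; exact: dgi.
rewrite -mulmxA mxE; apply: eq_bigr => i _.
rewrite deriveZ; last by apply: diff_derivable; exact: dgi.
rewrite derive_sum_partial; last exact: dgi.
rewrite !mxE; congr (_ * _).
by apply: eq_bigr => j _; rewrite mxE mulrC.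
Qed.

End MeanValue.

(** * Radii, ball inclusions and the Lipschitz error bound *)

Section Geometry.
Variables (R : realType) (n : nat).

Lemma enorm_col_le k (A : 'M[R]_(n, k)) j : enorm (col j A) <= maxcolnorm A.
Proof. exact: (le_bigmax _ (fun j => enorm (col j A))). Qed.

Lemma exists_col_neq0 k (A : 'M[R]_(n, k)) : A != 0 -> exists j, col j A != 0.
Proof.
move=> A0; apply: contrapT => /forallNP A'; case/eqP: A0; apply/matrixP => i j.
by have /negP := A' j; rewrite negbK => /eqP/colP/(_ i); rewrite !mxE.
Qed.

Lemma maxcolnorm_gt0 k (A : 'M[R]_(n, k)) : A != 0 -> 0 < maxcolnorm A.
Proof.
move=> /exists_col_neq0[j Aj].
exact: lt_le_trans (enorm_gt0 Aj) (enorm_col_le A j).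
Qed.

Lemma delta_l_gt0 m (k : 'I_m -> nat) (S : 'M[R]_(n, m))
    (T : forall i : 'I_m, 'M[R]_(n, k i)) :
  S != 0 -> (forall i, T i != 0) -> 0 < delta_l S T.
Proof.
by move=> S0 T0; apply: lt_bigmin => [|i _]; exact: maxcolnorm_gt0.
Qed.

Lemma delta_l_le_delta_u m (k : 'I_m -> nat) (S : 'M[R]_(n, m))
    (T : forall i : 'I_m, 'M[R]_(n, k i)) : delta_l S T <= delta_u S T.
Proof. exact: le_trans (bigmin_le_id _ _ _ _) (bigmax_ge_id _ _ _ _). Qed.

(** This is the equality case of the triangle inequality: [u] is [s] normalized, or [w] normalized
    when [s] vanishes. *)
Lemma exists_aligned_unit (w s : 'cV[R]_n) : w != 0 ->
  exists2 u : 'cV[R]_n, enorm u = 1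
    & forall a : R, 0 <= a -> enorm (s + a *: u) = enorm s + a.
Proof.
move=> w0.
have unit (v : 'cV[R]_n) : v != 0 -> enorm ((enorm v)^-1 *: v) = 1.
  move=> v0; rewrite enormZ ger0_norm ?invr_ge0 ?enorm_ge0 // mulVf //.
  by rewrite lt0r_neq0 // enorm_gt0.
have [->|s0] := eqVneq s 0.
  exists ((enorm w)^-1 *: w) => [|a a0]; first exact: unit.
  by rewrite add0r enorm0 add0r enormZ unit // mulr1 ger0_norm.
exists ((enorm s)^-1 *: s) => [|a a0]; first exact: unit.
have ns := enorm_gt0 s0.
rewrite scalerA -{1}[s]scale1r -scalerDl enormZ ger0_norm.
  by rewrite mulrDl mul1r -mulrA mulVf ?mulr1 // lt0r_neq0.
by rewrite addr_ge0 // mulr_ge0 // invr_ge0 ltW.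
Qed.

(* The nonzero vector w only serves to exclude n = 0. *)
Lemma eball_subset_radius (w x s : 'cV[R]_n) (r D : R) : w != 0 -> 0 < r ->
  eball (x + s) r `<=` eball x D -> enorm s + r <= D.
Proof.
move=> w0 r0 sub; have [u u1 uE] := exists_aligned_unit s w0.
rewrite leNgt; apply/negP => Dsr.
(* If [D < enorm s + r], then [a < r], so [x + (s + a *: u)] lies in the small ball, yet its
   distance to [x] is [enorm s + a], at least [D]. *)
pose a := Num.max 0 (D - enorm s).
have a0 : 0 <= a by rewrite le_max lexx.
have ar : a < r by rewrite gt_max r0 ltrBlDl.
have /sub : eball (x + s) r (x + (s + a *: u)).
  rewrite /eball /= addrA [X in X - _]addrC addrK.
  by rewrite enormZ u1 mulr1 ger0_norm.
rewrite /eball /= [X in X - _]addrC addrK uE // ltNge => /negP; apply.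
by rewrite -lerBlDl le_max lexx orbT.
Qed.

(** The intermediate point of [second_difference] is within [enorm s + enorm t] of [x]; the
    Lipschitz bound on the Hessian yields this factor, and Cauchy-Schwarz with the spectral norm
    yields the product of the lengths. *)
Lemma second_difference_error (D : set 'cV[R]_n) f (x s t : 'cV[R]_n)
    (r L : R) :
  0 <= L -> hess_lipschitz_on D (ecball x r) f L -> enorm s + enorm t <= r ->
  `|f (x + s + t) - f (x + s) - (f (x + t) - f x) - (s^T *m hess f x *m t) 0 0|
    <= L * (enorm s + enorm t) * (enorm s * enorm t).
Proof.
move=> L0 [twice lip] str.
have near_x (a b : R) : 0 <= a <= 1 -> 0 <= b <= 1 ->
    enorm (x + a *: s + b *: t - x) <= enorm s + enorm t.
  move=> /andP[a0 a1] /andP[b0 b1].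
  rewrite -(addrA x) [x + _]addrC addrK.
  apply: le_trans (enormD _ _) _; rewrite !enormZ !ger0_norm //.
  by rewrite lerD // ler_piMl // enorm_ge0.
have [|a [b [a01 b01 ->]]] := @second_difference R n f x s t.
  move=> a b a01 b01.
  have [|_ /nbhs_singleton df dg] := twice (x + a *: s + b *: t); last by [].
  exact: le_trans (near_x a b a01 b01) str.
set y := x + _ + _.
have yr : enorm (y - x) <= enorm s + enorm t by exact: near_x.
have -> : (s^T *m hess f y *m t) 0 0 - (s^T *m hess f x *m t) 0 0 =
    (s^T *m ((hess f y - hess f x) *m t)) 0 0.
  by rewrite mulmxBl mulmxBr !mulmxA [RHS]mxE; congr (_ + _); rewrite [RHS]mxE.
apply: le_trans (cauchy_schwarz _ _) _.
rewrite mulrCA ler_wpM2l ?enorm_ge0 //.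
apply: le_trans (enorm_mul _ _) _; rewrite ler_wpM2r ?enorm_ge0 //.
apply: le_trans (lip _ _ _ _) _.
- exact: le_trans yr str.
(* The centre [x] belongs to the closed ball because [str] forces [r] to be nonnegative. *)
- by rewrite /ecball /= subrr enorm0 (le_trans _ str) // addr_ge0 ?enorm_ge0.
- by rewrite ler_wpM2l.
Qed.

End Geometry.

(** * Projection identities and the common error estimate *)

Section SimplexHessian.
Variables (R : realType) (n m : nat) (k : 'I_m -> nat).
Variables (S : 'M[R]_(n, m)) (T : forall i : 'I_m, 'M[R]_(n, k i)).
Implicit Types (f : 'cV[R]_n -> R) (x : 'cV[R]_n) (H : 'M[R]_n).

(** The [i]-th summand retains only row [i] of the product with its own [T i], so all rows assemble
    into one matrix behind [mpinv S^T]. *)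
Lemma gshProjE H :
  gshProj S T H =
    mpinv S^T *m \matrix_(i < m) row i (S^T *m H *m T i *m mpinv (T i)).
Proof.
have -> : \matrix_(i < m) row i (S^T *m H *m T i *m mpinv (T i)) =
    \sum_(i < m) delta_mx i (0 : 'I_1)
      *m row i (S^T *m H *m T i *m mpinv (T i)).
  apply/matrixP => i j; rewrite summxE (bigD1 i) //= big1 => [|l li].
    by rewrite addr0 mxE [RHS]mxE big_ord1 [delta_mx _ _ _ _]mxE !eqxx mul1r.
  by rewrite mxE big_ord1 [delta_mx _ _ _ _]mxE eq_sym (negPf li) mul0r.
rewrite mulmx_sumr; apply: eq_bigr => i _.
by rewrite rowE trmx_delta !mulmxA.
Qed.

(** Row [i] is a row vector times [mpinv (T i)], which the second Penrose equation leaves fixed. *)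
Lemma row_simplex_delta2_proj f x (i : 'I_m) :
  row i (simplex_delta2 f x S T) *m T i *m mpinv (T i) =
  row i (simplex_delta2 f x S T).
Proof.
have [_ h2 _ _] := mpinvP (T i).
rewrite rowK -mulmxBr trmx_mul mpinv_tr trmxK -mulmxA -mulmxA.
by rewrite [mpinv _ *m _]mulmxA h2.
Qed.

(** If [S] has full column rank, [S^T *m mpinv S^T] is the identity and the remaining rows are
    already fixed. If every [T i] has full row rank, each [T i *m mpinv (T i)] is the identity and a
    Penrose equation for [S^T] finishes. *)
Lemma gshProj_gsh f x :
  (\rank S = m \/ forall i, \rank (T i) = n) ->
  gshProj S T (gsh f x S T) = gsh f x S T.
Proof.
move=> full; rewrite gshProjE /gsh.
case: full => [Sm | Tn].
  congr (_ *m _); apply/row_matrixP => i; rewrite rowK.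
  rewrite [S^T *m _]mulmxA mulmx_mpinv; last by rewrite /row_free mxrank_tr Sm.
  by rewrite mul1mx !row_mul row_simplex_delta2_proj.
set M := mpinv S^T *m simplex_delta2 f x S T.
have -> : \matrix_(i < m) row i (S^T *m M *m T i *m mpinv (T i)) = S^T *m M.
  apply/row_matrixP => i; rewrite rowK -mulmxA mulmx_mpinv ?mulmx1 //.
  by rewrite /row_free Tn.
have [_ h2 _ _] := mpinvP S^T.
by rewrite /M !mulmxA h2.
Qed.

(** Pseudoinversion is homogeneous of degree -1, so passing to the normalized matrix costs a factor
    [a^-1]. *)
Lemma opnorm_mpinv_scale p q (A : 'M[R]_(p, q)) (a : R) : 0 < a ->
  opnorm (mpinv A) <= a^-1 * opnorm (mpinv (a^-1 *: A)).
Proof.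
move=> a0; have aN : a != 0 by rewrite lt0r_neq0.
have -> : mpinv A = a^-1 *: mpinv (a^-1 *: A).
  by rewrite mpinvZ ?invr_eq0 // invrK scalerA mulVf // scale1r.
apply: le_trans (opnormZ _ _) _.
by rewrite ger0_norm // invr_ge0 ltW.
Qed.

(** The bounds [Du], [nT] and [K] are free parameters, so that a general family and a constant one
    can be treated with the same values. *)
Lemma gsh_error f x (D : set 'cV[R]_n) (L r Du nT : R) (K : nat) :
  0 <= L -> 0 <= nT -> hess_lipschitz_on D (ecball x r) f L ->
  0 < maxcolnorm S -> (forall i, 0 < maxcolnorm (T i)) ->
  (forall i, enorm (col i S) + maxcolnorm (T i) <= r) ->
  maxcolnorm S <= Du -> (forall i, maxcolnorm (T i) <= Du) ->
  (forall i, opnorm (mpinv (colnormalize (T i))) <= nT) ->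
  (forall i, k i <= K)%N ->
  opnorm (gsh f x S T - gshProj S T (hess f x)) <=
    2 * Num.sqrt (m * K)%:R * L * opnorm (mpinv (colnormalize S)^T) * nT * Du.
Proof.
move=> L0 nT0 lip S0 T0 STr SDu TDu TnT kK.
set DS := maxcolnorm S in S0 SDu *.
have Du0 : 0 <= Du by rewrite (le_trans _ SDu) // ltW.
(* Entry [j] of [e i] is the second-difference error for the directions [col i S] and
   [col j (T i)]. *)
pose e i : 'cV[R]_(k i) := simplex_delta f (x + col i S) (T i)
  - simplex_delta f x (T i) - ((col i S)^T *m hess f x *m T i)^T.
pose E := \matrix_(i < m) (mpinv (T i)^T *m e i)^T.
have -> : gsh f x S T - gshProj S T (hess f x) = mpinv S^T *m E.
  rewrite gshProjE /gsh -mulmxBr; congr (_ *m _).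
  apply/row_matrixP => i; rewrite linearB /= !rowK !row_mul -tr_col.
  rewrite /e mulmxBr [X in _ = X]linearB /= -mulmxBr; congr (_ - _).
  by rewrite trmx_mul trmxK mpinv_tr trmxK.
(* Only the sum of the lengths is enlarged, to [Du + Du], which is the source of the factor 2. The
   product keeps [DS] and [maxcolnorm (T i)], which cancel later against the inverse radii from
   normalization. *)
have eij i j : `|e i j 0| <= L * (Du + Du) * (DS * maxcolnorm (T i)).
  have -> : e i j 0 = f (x + col i S + col j (T i)) - f (x + col i S)
     - (f (x + col j (T i)) - f x)
     - ((col i S)^T *m hess f x *m col j (T i)) 0 0.
    have -> : ((col i S)^T *m hess f x *m col j (T i)) 0 0 =
        ((col i S)^T *m hess f x *m T i)^T j 0.
      rewrite [RHS]mxE [LHS]mxE [RHS]mxE; apply: eq_bigr => l _.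
      by rewrite [col _ _ _ _]mxE.
    rewrite /e [LHS]mxE [X in _ + X]mxE; congr (_ - _).
    by rewrite !mxE.
  have cS := enorm_col_le S i; have cT := enorm_col_le (T i) j.
  apply: le_trans (second_difference_error L0 lip _) _.
    by apply: le_trans (STr i); rewrite lerD2l.
  rewrite ler_pM ?mulr_ge0 ?addr_ge0 ?enorm_ge0 //.
    rewrite ler_wpM2l // lerD //; first exact: le_trans SDu.
    exact: le_trans (TDu i).
  by rewrite ler_pM ?enorm_ge0.
have row_bound i :
    enorm (row i E)^T <= Num.sqrt K%:R * (L * (Du + Du) * DS * nT).
  rewrite rowK trmxK.
  apply: le_trans (enorm_mul _ _) _.
  have c0 : 0 <= L * (Du + Du) * (DS * maxcolnorm (T i)).
    by rewrite !mulr_ge0 ?addr_ge0 //; exact: ltW.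
  have := enorm_le_const c0 (eij i) => en.
  have op : opnorm (mpinv (T i)^T) <= (maxcolnorm (T i))^-1 * nT.
    rewrite mpinv_tr; apply: le_trans (opnorm_tr _) _.
    apply: le_trans (opnorm_mpinv_scale _ (T0 i)) _.
    by apply: ler_wpM2l => //; rewrite invr_ge0 ltW.
  apply: le_trans (ler_pM _ _ op en) _; rewrite ?opnorm_ge0 ?enorm_ge0 //.
  have -> : (maxcolnorm (T i))^-1 * nT *
     (Num.sqrt (k i)%:R * (L * (Du + Du) * (DS * maxcolnorm (T i)))) =
     Num.sqrt (k i)%:R * (L * (Du + Du) * DS * nT).
    by field; rewrite lt0r_neq0.
  rewrite ler_wpM2r ?mulr_ge0 ?addr_ge0 ?(ltW S0) //.
  by rewrite ler_sqrt ?ler0n // ler_nat.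
apply: le_trans (opnormM _ _) _.
have opS := opnorm_mpinv_scale S^T S0.
have opE := opnorm_le_rows _ row_bound.
apply: le_trans (ler_pM _ _ opS (opE _)) _; rewrite ?opnorm_ge0 //.
  by rewrite !mulr_ge0 ?addr_ge0 ?sqrtr_ge0 ?(ltW S0).
rewrite natrM sqrtrM ?ler0n // /colnormalize [(_ *: S)^T]linearZ /= -/DS.
(* Both sides are equal once [DS] cancels against the inverse radius in [opS]. *)
rewrite le_eqVlt; apply/orP; left; apply/eqP.
by field; rewrite lt0r_neq0.
Qed.

End SimplexHessian.

(** * The case of a common [T], and the final bounds *)

(** With a common [T] the projection is a two-sided product, and the second Penrose equations for
    [S^T] and for [T] absorb the two sides separately. *)
Lemma gshProj_gsh_const (R : realType) n m k (S : 'M[R]_(n, m))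
    (T : 'M[R]_(n, k)) f x :
  gshProj S (fun=> T) (gsh f x S (fun=> T)) = gsh f x S (fun=> T).
Proof.
rewrite gshProj_const /gsh.
have [_ h2 _ _] := mpinvP S^T.
rewrite [_ *m (mpinv S^T *m _)]mulmxA h2 -!mulmxA; congr (_ *m _).
apply/row_matrixP => i; rewrite mulmxA !row_mul.
exact: (row_simplex_delta2_proj S (fun=> T)).
Qed.

Theorem theorem4p2 (R : realType) (n m : nat) (k : 'I_m -> nat)
    (domf : set 'cV[R]_n) (f : 'cV[R]_n -> R) (x0 : 'cV[R]_n) (Dbar L : R)
    (S : 'M[R]_(n, m)) (T : forall i : 'I_m, 'M[R]_(n, k i)) (iT : 'I_m)
    (hx0 : domf x0) (hDbar : 0 < Dbar)
    (hdom : eball x0 Dbar `<=` domf)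
    (hC3 : C_on 3 (eball x0 Dbar) f)
    (hL : 0 <= L)
    (hLip : hess_lipschitz_on domf (ecball x0 Dbar) f L)
    (hS : S != 0) (hT : forall i, T i != 0)
    (hball0 : forall i, eball x0 (maxcolnorm (T i)) `<=` eball x0 Dbar)
    (hballS : forall i,
       eball (x0 + col i S) (maxcolnorm (T i)) `<=` eball x0 Dbar)
    (hiT : forall i, opnorm (mpinv (colnormalize (T i)))
                     <= opnorm (mpinv (colnormalize (T iT)))) :
  let kmax := (\max_(i < m) k i)%N in
  let Du := delta_u S T in
  let Dl := delta_l S T in
  let nS := opnorm (mpinv (colnormalize S)^T) in
  let nT := opnorm (mpinv (colnormalize (T iT))) in
  ((\rank S = m \/ forall i, \rank (T i) = n) ->
     opnorm (gshProj S T (gsh f x0 S T) - gshProj S T (hess f x0))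
       = opnorm (gsh f x0 S T - gshProj S T (hess f x0))
     /\ opnorm (gsh f x0 S T - gshProj S T (hess f x0))
       <= 4 * m%:R * Num.sqrt kmax%:R * L * nS * nT * (Du / Dl) ^+ 2 * Du)
  /\
  (forall (kbar : nat) (Tbar : 'M[R]_(n, kbar)),
     (forall i, existT (fun p => 'M[R]_(n, p)) (k i) (T i)
                = existT (fun p => 'M[R]_(n, p)) kbar Tbar) ->
     let TT := fun _ : 'I_m => Tbar in
     opnorm (gshProj S TT (gsh f x0 S TT) - gshProj S TT (hess f x0))
       = opnorm (gsh f x0 S TT - gshProj S TT (hess f x0))
     /\ opnorm (gsh f x0 S TT - gshProj S TT (hess f x0))
       <= 4 * Num.sqrt (m * kmax)%:R * L * (Du / Dl) * nS * nT * Du).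
Proof.
move=> kmax Du Dl nS nT.
have S0 := maxcolnorm_gt0 hS.
have T0 i := maxcolnorm_gt0 (hT i).
(* This column is the nonzero vector that [eball_subset_radius] asks for. *)
have [j w0] := exists_col_neq0 (hT iT).
have STr i : enorm (col i S) + maxcolnorm (T i) <= Dbar.
  exact: eball_subset_radius w0 (T0 i) (hballS i).
have SDu : maxcolnorm S <= Du by exact: bigmax_ge_id.
have TDu i : maxcolnorm (T i) <= Du.
  exact: (le_bigmax _ (fun i => maxcolnorm (T i))).
have kK i : (k i <= kmax)%N by exact: (leq_bigmax i).
have nS0 : 0 <= nS by exact: opnorm_ge0.
have nT0 : 0 <= nT by exact: opnorm_ge0.
have Du0 : 0 <= Du by rewrite (le_trans _ SDu) // ltW.
have q1 : 1 <= Du / Dl.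
  by rewrite ler_pdivlMr ?mul1r ?delta_l_le_delta_u ?delta_l_gt0.
have sqrt0 (a : R) : 0 <= Num.sqrt a by exact: sqrtr_ge0.
have const0 : 0 <= L * nS * nT * Du by rewrite !mulr_ge0.
split=> [full | kbar Tbar TE TT].
  rewrite gshProj_gsh //; split=> //.
  apply: le_trans (gsh_error hL nT0 hLip S0 T0 STr SDu TDu hiT kK) _.
  rewrite -/nS natrM sqrtrM ?ler0n //.
  (* The index [iT] forces [m] to be positive, so the square root of [m] is at most [m]. *)
  have m1 : 1 <= m%:R :> R by rewrite ler1n (leq_ltn_trans _ (ltn_ord iT)).
  have sm : Num.sqrt m%:R <= m%:R :> R.
    rewrite -[leRHS]ger0_norm ?ler0n // -sqrtr_sqr ler_sqrt ?sqr_ge0 //.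
    by rewrite expr2 ler_peMr ?ler0n.
  have q2 : 1 <= (Du / Dl) ^+ 2 by rewrite exprn_ege1.
  have c0 : 0 <= Num.sqrt kmax%:R * (L * nS * nT * Du) by rewrite mulr_ge0.
  apply: (@le_trans _ _
      (4 * m%:R * 1 * (Num.sqrt kmax%:R * (L * nS * nT * Du)))).
    have -> : 2 * (Num.sqrt m%:R * Num.sqrt kmax%:R) * L * nS * nT * Du =
       (2 * Num.sqrt m%:R) * (Num.sqrt kmax%:R * (L * nS * nT * Du)) by ring.
    by rewrite ler_wpM2r // mulr1 ler_pM // ler_nat.
  have -> : 4 * m%:R * Num.sqrt kmax%:R * L * nS * nT * (Du / Dl) ^+ 2 * Du =
    4 * m%:R * (Du / Dl) ^+ 2 * (Num.sqrt kmax%:R * (L * nS * nT * Du)) by ring.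
  by rewrite ler_wpM2r // ler_wpM2l // mulr_ge0.
(* The equalities [TE] relate dependent pairs, because the column counts [k i] may differ a priori;
   any quantity [P] defined for all column counts transports along them. *)
have TbE X (P : forall p, 'M[R]_(n, p) -> X) i : P _ (T i) = P _ Tbar.
  exact: (congr1 (fun z => P (projT1 z) (projT2 z)) (TE i)).
have cE i : maxcolnorm (T i) = maxcolnorm Tbar.
  exact: (TbE _ (fun p => @maxcolnorm R n p)).
rewrite gshProj_gsh_const; split=> //.
(* The estimate is used for the constant family, with [Du], [nT] and [kmax] taken from the family
   [T]. *)
apply: (le_trans
  (gsh_error (T := TT) (K := kmax) hL nT0 hLip S0 _ _ SDu _ _ _)).
1-3: by move=> i; rewrite /TT -(cE i).
- move=> i; pose N p (A : 'M[R]_(n, p)) := opnorm (mpinv (colnormalize A)).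
  by have := hiT i; rewrite -/(N _ (T i)) (TbE _ N i).
- by move=> i; rewrite -(TbE _ (fun p _ => p) i).
rewrite -/nS.
have c0 : 0 <= Num.sqrt (m * kmax)%:R * (L * nS * nT * Du) by rewrite mulr_ge0.
have -> : 2 * Num.sqrt (m * kmax)%:R * L * nS * nT * Du =
  2 * 1 * (Num.sqrt (m * kmax)%:R * (L * nS * nT * Du)) by ring.
have -> : 4 * Num.sqrt (m * kmax)%:R * L * (Du / Dl) * nS * nT * Du =
  4 * (Du / Dl) * (Num.sqrt (m * kmax)%:R * (L * nS * nT * Du)) by ring.
by rewrite ler_wpM2r // ler_pM // ler_nat.
Qed.
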